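(* Let $c>0$ and $1\le\alpha\le 2$, and consider the symmetric (around zero) stable distribution with characteristic function $\varphi_X(u)=e^{-c|u|^{\alpha}}$, $u\in\mathbb{R}$. Then its characteristic curvature $\Phi(c;\alpha)$ satisfies $$\Phi(c;\alpha)=\frac{2}{\sqrt{2\pi}}\int_{0}^{\infty}\Big(-\frac{\partial^2\ln\varphi_X(u)}{\partial u^2}\Big)e^{-cu^{\alpha}}\,du=\frac{2}{\sqrt{2\pi}}\,\alpha\,\Gamma\Big(2-\frac{1}{\alpha}\Big)c^{\frac1\alpha}=\frac{2}{H\sqrt{2\pi}}\,\Gamma(2-H)\,c^{H},$$ where $\Gamma$ is the Euler Gamma function and $H=\frac{1}{\alpha}$ is the Hurst exponent.
   Context: The characteristic function of a real random variable $X$ is $\varphi_X(u)=\mathbb{E}(e^{iuX})$, $u\in\mathbb{R}$. The characteristic curvature of a probability distribution symmetric around zero with characteristic function $\varphi_X$ is $$\Phi=\frac{2}{\sqrt{2\pi}}\int_{0}^{\infty}\Big(-\frac{\partial^2\ln\varphi_X(u)}{\partial u^2}\Big)\varphi_X(u)\,du,$$ where $\varphi_X$ is considered on $u\ge 0$. For the symmetric stable distribution with characteristic function $e^{-c|u|^{\alpha}}$ the characteristic curvature is denoted $\Phi(c;\alpha)$. The Hurst exponent is $H=1/\alpha$.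
   Formalization: The closed form with the pointwise second derivative is proved for 1<α≤2 only, since at α=1 that integral is 0; for all 1≤α≤2, including α=1, it is proved with the second derivative of ln φ taken in the distributional sense, half of the atom at 0 being counted. *)

(* Defs.v *)
From HB Require Import structures.
From mathcomp Require Import all_boot all_order all_algebra.
From mathcomp Require Import complex.
From mathcomp Require Import all_classical all_reals all_analysis.

Set Implicit Arguments.
Unset Strict Implicit.
Unset Printing Implicit Defensive.

Import Order.TTheory GRing.Theory Num.Theory.
Import numFieldNormedType.Exports.

Local Open Scope classical_set_scope.
Local Open Scope ring_scope.

Section CharacteristicCurvature.
Context {d : measure_display} {T : measurableType d} {R : realType}.
Variables (P : probability T R) (X : {RV P >-> R}).

(* E(e^{iuX}) = E(cos(uX)) + i E(sin(uX)); both expectations are finite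
   because their integrands are bounded by 1. *)
Definition char_fun (u : R) : R[i] :=
  Complex (fine 'E_P[fun w => cos (u * X w)])
          (fine 'E_P[fun w => sin (u * X w)]).

(* For a distribution symmetric around zero, char_fun is real, so this is
   char_fun itself, viewed as a function from R to R. *)
Definition real_char_fun (u : R) : R := complex.Re (char_fun u).

Definition log_char_fun (u : R) : R := ln (real_char_fun u).

(* The second derivative is taken pointwise. The half-line is open because
   the second derivative need not exist at 0; a point is Lebesgue-null. *)
Definition char_curvature : \bar R :=
  ((2 / Num.sqrt (2 * pi))%:E *
   \int[lebesgue_measure]_(u in `]0%R, +oo[)
     ((- (derive1n 2 log_char_fun u)) * real_char_fun u)%:E)%E.

(* The same quantity with the second derivative taken in the sense of
   distributions, for log-concave characteristic functions. The second
   derivative of the convex function - ln phi is the Lebesgue-Stieltjes measure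
   dG of its right derivative G; it may have an atom at 0 when ln phi has a
   corner there. By symmetry, 2 int_0^oo is the integral over the whole line,
   so that an atom at the endpoint 0 counts for one half in int_0^oo. When
   ln phi is C^1 with absolutely continuous derivative, dG is
   - (ln phi)''(u) du and this is char_curvature. G is unique if it exists. *)
Definition is_distributional_char_curvature (Phi : \bar R) : Prop :=
  exists G : cumulative R R,
    (forall u : R,
       h^-1 * (- log_char_fun (u + h) - - log_char_fun u) @[h --> 0^'+]
         --> G u) /\
    Phi = ((1 / Num.sqrt (2 * pi))%:E *
           \int[lebesgue_stieltjes_measure G]_u (real_char_fun u)%:E)%E.

End CharacteristicCurvature.

Arguments char_fun {d T R} P X u.
Arguments real_char_fun {d T R} P X u.
Arguments log_char_fun {d T R} P X u.
Arguments char_curvature {d T R} P X.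
Arguments is_distributional_char_curvature {d T R} P X Phi.

(* Euler's integral of the second kind; the Gamma function for 0 < z only. *)
Definition Gamma {R : realType} (z : R) : R :=
  \int[lebesgue_measure]_(t in `]0, +oo[) (t `^ (z - 1) * expR (- t)).

(* Main.v *)
Require Import Defs.
From HB Require Import structures.
From mathcomp Require Import all_boot all_order all_algebra.
From mathcomp Require Import complex.
From mathcomp Require Import all_classical all_reals all_analysis.
From mathcomp Require Import ring lra.
From mathcomp Require Import measurable_realfun.

Import Order.TTheory GRing.Theory Num.Theory.
Import numFieldNormedType.Exports.

Local Open Scope classical_set_scope.
Local Open Scope ring_scope.

(** Write phi(u) = exp(- c |u|^alpha), so that - ln phi(u) = c |u|^alpha. Its
    right derivative G is c alpha u^(alpha - 1) for u >= 0, extended to u < 0 by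
    G(u) = - G(- u), and the curvature is the integral of phi against dG. For alpha > 1 this
    measure has the density c alpha (alpha - 1) |u|^(alpha - 2), which may be
    unbounded at 0; for alpha = 1 it is an atom of mass 2 c at 0.

    Both cases become one computation if phi is written as the integral of its
    own slope over a tail: with f = - phi' on ]0, +oo[ one has
    phi(u) = int_|u|^oo f (integral_stable_tail). Tonelli's theorem then gives,
    for any sigma-finite measure nu (layer_cake),

      int phi dnu = int_0^oo f(s) nu(]- s, s]) ds,

    so that only the nu-mass of centred intervals matters, and the corner or
    singularity at 0 disappears. The mass of ]- s, s] is
    G(s) - G(- s) = 2 c alpha s^(alpha - 1) for dG, and half of this for the
    density on ]0, +oo[ (integral_stable_curvature_density). In both cases
    what remains is a multiple of

      int_0^oo (c alpha s^(alpha - 1))^2 exp(- c s^alpha) ds,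

    and the substitution t = c s^alpha turns it into
    alpha c^(1/alpha) int_0^oo t^(1 - 1/alpha) exp(- t) dt, which is
    alpha c^(1/alpha) Gamma(2 - 1/alpha) (integral_sqr_stable_slope). The
    argument of Gamma comes out directly, without its functional equation. *)

(** * Powers on the half-line *)

Lemma powR_cvg_at_right0 (R : realType) (p : R) :
  0 <= p -> x `^ p @[x --> 0^'+] --> 0 `^ p.
Proof.
rewrite le_eqVlt => /predU1P[<-|p0].
  by rewrite powRr0; under eq_cvg do rewrite powRr0; exact: cvg_cst.
by rewrite powR0 ?gt_eqF//; exact: powR_cvg0.
Qed.

Lemma continuous_powR (R : realType) (p x : R) :
  0 < x -> {for x, continuous (@powR R ^~ p)}.
Proof.
move=> x0; apply/differentiable_continuous/derivable1_diffP.
by apply: derivable_powR; rewrite in_itv/= x0.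
Qed.

Lemma powR_cvg_at_right (R : realType) (p u : R) : 0 <= p -> 0 <= u ->
  x `^ p @[x --> u^'+] --> u `^ p.
Proof.
move=> p0; rewrite le_eqVlt => /predU1P[<-|u0]; first exact: powR_cvg_at_right0.
exact/cvg_at_right_filter/continuous_powR.
Qed.

Lemma is_derive_scaled_powR (R : realType) (k p x : R) : 0 < x ->
  is_derive x 1 (fun u => k * u `^ p) (k * p * x `^ (p - 1)).
Proof.
move=> x0; apply: is_derive_eq.
  exact: (is_deriveZ k (is_derive1_powR p x0)).
by rewrite /GRing.scale/= mulrA.
Qed.

Lemma derive1_scaled_powR (R : realType) (k p x : R) : 0 < x ->
  ((fun u => k * u `^ p)^`())%classic x = k * p * x `^ (p - 1).
Proof.
by move=> x0; rewrite derive1E; case: (is_derive_scaled_powR R k p x x0).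
Qed.

Lemma scaled_powR_cvgy (R : realType) (k p : R) : 0 < k -> 1 <= p ->
  k * x `^ p @[x --> +oo] --> +oo.
Proof.
move=> k0 p1; apply: gt0_cvgMry => //; apply/cvgryPge => A.
near=> x; apply: (@le_trans _ _ x).
  by near: x; apply: nbhs_pinfty_ge; exact: num_real.
by apply: le1r_powR => //; near: x; apply: nbhs_pinfty_ge; exact: num_real.
Unshelve. all: by end_near. Qed.

(** * Integration over half-open and unbounded intervals *)

(** The integrand may blow up at the left endpoint: the classical formula holds
    on `[u n, b] for a sequence u n decreasing to a, and monotone convergence
    passes to the limit. *)
Lemma ge0_continuous_FTC2_oc (R : realType) (f F : R -> R) (a b : R) :
  a < b -> (forall x, a < x -> 0 <= f x) ->
  (forall x, a < x -> {for x, continuous f}) ->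
  (forall x : R, a < x -> is_derive x 1 F (f x)) ->
  F x @[x --> a^'+] --> F a ->
  (\int[lebesgue_measure]_(x in `]a, b]) (f x)%:E = (F b - F a)%:E)%E.
Proof.
move=> ab f0 cf dF Fa.
pose u (n : nat) : R := a + (b - a) * n.+1%:R^-1.
have ua n : a < u n by rewrite ltrDl mulr_gt0 ?subr_gt0// invr_gt0 ltr0n.
have u_le m n : (m <= n)%N -> u n <= u m.
  move=> mn; rewrite lerD2l ler_wpM2l//; first by rewrite subr_ge0 ltW.
  by rewrite lef_pV2 ?posrE ?ltr0n// ler_nat.
have ub n : u n <= b.
  by rewrite (le_trans (u_le 0 n _))// /u invr1 mulr1 addrC subrK.
have u_cvg : u n @[n --> \oo] --> a.
  rewrite -[X in _ --> X]addr0; apply: cvgD; first exact: cvg_cst.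
  rewrite -[X in _ --> X](mulr0 (b - a)); apply: cvgMl_tmp.
  exact: cvg_harmonic.
pose S (n : nat) := `[u n, b]%classic.
have SU : \bigcup_n S n = `]a, b]%classic.
  apply/seteqP; split => [y [n _]|y]; rewrite /S /= !in_itv/=.
    by move=> /andP[uy ->]; rewrite (lt_le_trans (ua n) uy).
  move=> /andP[ay yb].
  have [N _ uN] : \forall n \near \oo, u n < y.
    exact: cvgr_lt u_cvg _ ay.
  by exists N => //=; rewrite in_itv/= yb andbT ltW// uN/=.
have ndS : nondecreasing_seq S.
  move=> m n mn; rewrite subsetEset; apply: subset_itvr.
  by rewrite bnd_simp u_le.
have mf : measurable_fun `]a, +oo[ f.
  apply: open_continuous_measurable_fun => // y.
  by rewrite inE/= in_itv/= andbT; exact: cf.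
have Sa n : S n `<=` `]a, +oo[.
  move=> y; rewrite /S/= !in_itv/= => /andP[uy _].
  by rewrite (lt_le_trans (ua n) uy).
rewrite -SU.
apply: (@cvg_unique _ (@ereal_hausdorff R)
    (\int[lebesgue_measure]_(x in S n) (f x)%:E @[n --> \oo])%E).
  apply: ge0_nondecreasing_set_cvg_integral => //.
  - by move=> n; exact: measurable_itv.
  - by move=> n; apply/measurable_EFinP; exact: measurable_funS mf.
  - move=> n y /Sa; rewrite /= in_itv/= andbT => ay.
    by rewrite lee_fin f0.
rewrite (_ : (fun n => _) = EFin \o (fun n => F b - F (u n))); last first.
  apply/funext => n /=; have := ub n.
  rewrite /S le_eqVlt => /predU1P[->|unb].
    by rewrite set_itv1 integral_set1 subrr.
  have cF x : a < x -> {for x, continuous F}.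
    move=> ax; apply/differentiable_continuous/derivable1_diffP.
    by case: (dF x ax).
  rewrite (@continuous_FTC2 _ _ F)//.
  - apply/continuous_within_itvP => //; split.
    + by move=> x; rewrite in_itv/= => /andP[ux _]; apply/cf/(lt_trans (ua n)).
    + exact/cvg_at_right_filter/cf.
    + exact/cvg_at_left_filter/cf.
  - split.
    + move=> x; rewrite in_itv/= => /andP[ux _].
      by case: (dF x (lt_trans (ua n) ux)).
    + exact/cvg_at_right_filter/cF.
    + exact/cvg_at_left_filter/cF.
  - move=> x; rewrite in_itv/= => /andP[ux _]; rewrite derive1E.
    by case: (dF x (lt_trans (ua n) ux)).
apply: cvg_EFin; first exact: nearW.
apply: cvgB; first exact: cvg_cst.
by apply: (@cvg_at_rightP _ _ _ _).1 Fa _ _.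
Qed.

(** The case in view is F x = c * x `^ p with p > 1, whose derivative diverges at
    infinity. The formula on bounded intervals sees only finite values of the
    derivative, and monotone convergence passes to the limit. *)
Lemma increasing_ge0_integration_by_substitution_obndy (R : realType)
    (F G : R -> R) (a : R) :
  {in `[a, +oo[ &, {homo F : x y / x < y}} ->
  {in `]a, +oo[, continuous F^`()%classic} ->
  cvg (F^`()%classic x @[x --> a^'+]) ->
  derivable_oy_Rcontinuous F a -> F x @[x --> +oo] --> +oo ->
  {within `[F a, +oo[, continuous G} ->
  {in `]F a, +oo[, forall y, 0 <= G y} ->
  (\int[lebesgue_measure]_(y in `]F a, +oo[) (G y)%:E =
   \int[lebesgue_measure]_(x in `]a, +oo[) (G (F x) * F^`()%classic x)%:E)%E.
Proof.
move=> incrF cF' F'a [dF Fa] Fy /[dup] cG /continuous_within_itvcyP[cG1 cGa] G0.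
have F'0 x : a < x -> 0 <= F^`()%classic x.
  move=> ax; apply: (@incr_derive1_ge0_itvy _ F true a) incrF _ => [y|].
    by rewrite inE; exact: dF.
  by rewrite in_itv/= ax.
have mG : measurable_fun `]F a, +oo[ G.
  by apply: open_continuous_measurable_fun => // y; rewrite inE/=; exact: cG1.
have aF x : a < x -> F a < F x.
  by move=> ax; apply: incrF => //; rewrite in_itv/= ?lexx// ltW.
have cF x : a < x -> {for x, continuous F}.
  move=> ax; apply/differentiable_continuous/derivable1_diffP/dF.
  by rewrite ?in_itv/= ax.
have mGF : measurable_fun `]a, +oo[ (fun x => G (F x) * F^`()%classic x).
  apply: open_continuous_measurable_fun => // x; rewrite inE/= in_itv/= andbT.
  move=> ax; apply: cvgM; last by apply: cF'; rewrite in_itv/= ax.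
  apply: continuous_comp; first exact: cF.
  by apply: cG1; rewrite in_itv/= aF.
pose S (n : nat) := `]a, a + n%:R]%classic.
pose T (n : nat) := `]F a, F (a + n%:R)]%classic.
have ndS : nondecreasing_seq S.
  move=> m n mn; rewrite subsetEset; apply: subset_itvl.
  by rewrite bnd_simp lerD2l ler_nat.
have ndT : nondecreasing_seq T.
  move=> m n mn; rewrite subsetEset; apply: subset_itvl.
  rewrite bnd_simp; move: mn; rewrite leq_eqVlt => /predU1P[->//|mn].
  by apply/ltW/incrF; rewrite ?in_itv/= ?lerDl ?ltrD2l ?ltr_nat ?ler0n.
have SU : \bigcup_i S i = `]a, +oo[%classic by rewrite itv_bndy_bigcup_BRight.
have TU : \bigcup_i T i = `]F a, +oo[%classic.
  apply/seteqP; split => [y [n _]|y]; rewrite /T /= !in_itv/=.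
    by move=> /andP[->].
  rewrite andbT => Fay.
  have [M [_ MF]] : \forall x \near +oo, y <= F x.
    by move/cvgryPge : Fy; apply.
  exists (Num.truncn (`|M| + `|a|)).+1 => //=.
  rewrite in_itv/= Fay/=; apply: MF.
  have := truncnS_gt (`|M| + `|a|); have := ler_norm M; have := ler_norm (- a).
  by rewrite normrN; lra.
have mGT n : measurable_fun (T n) G.
  by apply: measurable_funS mG => //; exact: subset_itvl.
have mGFS n : measurable_fun (S n) (fun x => G (F x) * F^`()%classic x).
  by apply: measurable_funS mGF => //; exact: subset_itvl.
have ST n : (\int[lebesgue_measure]_(y in T n) (G y)%:E =
    \int[lebesgue_measure]_(x in S n) (G (F x) * F^`()%classic x)%:E)%E.
  have [->|n0] := posnP n.
    by rewrite /T /S addr0 !set_itvoc0 !integral_set0.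
  have an : a < a + n%:R by rewrite ltrDl ltr0n.
  have Fan := aF _ an.
  rewrite /T /S !integral_itv_obnd_cbnd; last 2 first.
  - by apply/measurable_EFinP; exact: (mGFS n).
  - by apply/measurable_EFinP; exact: (mGT n).
  apply: integration_by_substitution_increasing.
  - exact: ltW.
  - by apply: sub_in2 incrF => x; rewrite !in_itv/= => /andP[->].
  - move=> x; rewrite in_itv/= => /andP[ax _].
    by apply: cF'; rewrite in_itv/= ax.
  - exact: F'a.
  - apply/cvg_ex; eexists; apply/cvg_at_left_filter/cF'.
    by rewrite in_itv/= an.
  - split=> //; last exact/cvg_at_left_filter/cF.
    move=> x; rewrite in_itv/= => /andP[ax _].
    by apply: dF; rewrite in_itv/= ax.
  - by apply: continuous_subspaceW cG; exact: subset_itvl.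
rewrite -SU -TU.
apply: (@cvg_unique _ (@ereal_hausdorff R)
    (\int[lebesgue_measure]_(y in T n) (G y)%:E @[n --> \oo])%E).
  apply: ge0_nondecreasing_set_cvg_integral => //.
  - by move=> n; exact: measurable_itv.
  - by move=> n; apply/measurable_EFinP; exact: mGT.
  - move=> n y; rewrite /T/= in_itv/= => /andP[Fay _].
    by rewrite lee_fin G0// in_itv/= Fay.
rewrite (funext ST).
apply: ge0_nondecreasing_set_cvg_integral => //.
- by move=> n; exact: measurable_itv.
- by move=> n; apply/measurable_EFinP; exact: mGFS.
- move=> n x; rewrite /S/= in_itv/= => /andP[ax _].
  by rewrite lee_fin mulr_ge0 ?F'0// G0// in_itv/= aF.
Qed.

(** * Euler's integral *)

(** The real-valued integral defining Gamma is the finite part of an extended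
    integral; here that integral is shown to be finite, by domination by
    2 * expR (- (t / 2)). The range of z is what makes
    t `^ (z - 1) <= 1 + t. *)
Lemma Gamma_integralE (R : realType) (z : R) : 1 <= z <= 2 ->
  (Gamma z)%:E =
  (\int[lebesgue_measure]_(t in `]0%R, +oo[) (t `^ (z - 1) * expR (- t))%:E)%E.
Proof.
move=> /andP[z1 z2].
have mpow : measurable_fun setT (fun t : R => t `^ (z - 1) * expR (- t)).
  apply: measurable_funM => //.
  exact: measurableT_comp.
rewrite /Gamma /Rintegral fineK// ge0_fin_numE; last first.
  by apply: integral_ge0 => t _; rewrite lee_fin mulr_ge0 ?powR_ge0 ?expR_ge0.
pose F (t : R) := - 4 * expR (- (t / 2)).
have dF (t : R) : is_derive t 1 F (2 * expR (- (t / 2))).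
  rewrite /F.
  apply: is_derive_eq.
  by rewrite /GRing.scale/=; field.
have mexp : measurable_fun setT (fun t : R => 2 * expR (- (t / 2))).
  apply: measurable_funM => //; apply: measurableT_comp => //.
  by apply: measurableT_comp => //; exact: measurable_funM.
have powle (t : R) : 0 <= t -> t `^ (z - 1) <= 2 * expR (t / 2).
  move=> t0; have expt := expR_ge1Dx (t / 2).
  apply: (@le_trans _ _ (1 + t)); last lra.
  have [t1|t1] := leP t 1.
    rewrite (@le_trans _ _ 1)//; last by rewrite lerDl.
    rewrite -[leRHS](congr1 (@^~ (z - 1)) (@powR1 R)).
    by rewrite ge0_ler_powR ?nnegrE ?subr_ge0.
  rewrite (@le_trans _ _ t)//; last by rewrite lerDr.
  by rewrite -[leRHS](powRr1 t0) ler_powR ?(ltW t1)//; lra.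
apply: (@le_lt_trans _ _
    (\int[lebesgue_measure]_(t in `[0%R, +oo[) (2 * expR (- (t / 2)))%:E)%E).
  rewrite integral_itv_obnd_cbnd//; last first.
    exact/measurable_EFinP/measurable_funTS.
  apply: ge0_le_integral => //=.
  - by move=> t _; rewrite lee_fin mulr_ge0 ?powR_ge0 ?expR_ge0.
  - exact/measurable_EFinP/measurable_funTS.
  - exact/measurable_EFinP/measurable_funTS.
  - move=> t; rewrite in_itv/= andbT lee_fin => t0.
    rewrite [leRHS](_ : _ = 2 * expR (t / 2) * expR (- t)); last first.
      by rewrite -mulrA -expRD; congr (_ * expR _); field.
    rewrite ler_wpM2r ?expR_ge0//.
    exact: powle.
rewrite (@ge0_continuous_FTC2y _ _ F _ 0)//.
- by rewrite ltry.
- apply: continuous_subspaceT => t.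
  apply/differentiable_continuous/derivable1_diffP.
  by apply: ex_derive.
- rewrite -(mulr0 (- 4)); apply: cvgMl_tmp.
  apply: (@cvg_comp _ _ _ (fun t : R => t / 2) (fun t => expR (- t)) _ +oo).
    by apply: gt0_cvgMly.
  exact: cvgr_expR.
- apply: cvg_at_right_filter; apply/differentiable_continuous.
  by apply/derivable1_diffP; case: (dF 0).
- by move=> t _; rewrite derive1E derive_val.
Qed.

(** * Layer-cake formula and Lebesgue-Stieltjes measures *)

(** If phi u is the integral of f over the tail beyond u, then phi `|u| is the
    integral of f s over the s > 0 with u in `]- s, s] (up to one point), and
    Tonelli's theorem exchanges the two integrations. Half-open intervals are
    the ones whose Lebesgue-Stieltjes measure is known. The weight g serves
    measures with a density. *)
Lemma layer_cake (R : realType)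
    (nu : {sigma_finite_measure set (measurableTypeR R) -> \bar R})
    (g : R -> \bar R) (f phi : R -> R) :
  measurable_fun setT g -> (forall u, 0 <= g u)%E ->
  measurable_fun `](0 : R), +oo[ f -> (forall s, 0 < s -> 0 <= f s) ->
  (forall u : R, 0 <= u ->
    (\int[lebesgue_measure]_(s in `]u, +oo[) (f s)%:E = (phi u)%:E)%E) ->
  (\int[nu]_u (g u * (phi `|u|)%:E) =
   \int[lebesgue_measure]_(s in `]0%R, +oo[)
     ((f s)%:E * \int[nu]_(u in `](- s)%R, s]) g u))%E.
Proof.
move=> mg g0 mf f0 fphi.
pose GR := measurableTypeR R.
pose D := [set` `]0, +oo[%R] : set R.
pose f' : R -> \bar R := (EFin \o f) \_ D.
have f'0 s : (0 <= f' s)%E.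
  rewrite /f' patchE; case: ifPn => //; rewrite inE /D/= in_itv/= andbT => s0.
  by rewrite lee_fin f0.
have mf' : measurable_fun setT f'.
  by apply/(measurable_restrictT _ (measurable_itv _))/measurable_EFinP.
pose A : set (R * R) := [set p | `]- p.2, p.2]%classic p.1].
have mA : measurable A.
  have m1 : measurable_fun setT (fun p : R * R => - p.2 < p.1).
    by apply: measurable_fun_ltr => //; exact: measurableT_comp.
  have m2 : measurable_fun setT (fun p : R * R => p.1 <= p.2).
    exact: measurable_fun_ler.
  rewrite [A](_ : _ =
      (fun p : R * R => - p.2 < p.1) @^-1` [set true] `&`
      (fun p : R * R => p.1 <= p.2) @^-1` [set true]).
    by apply: measurableI; [have := m1 measurableT [set true]
      | have := m2 measurableT [set true]]; rewrite setTI; exact.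
  by apply/seteqP; split => p; rewrite /A /= in_itv/= => /andP.
pose h (p : R * R) : \bar R := (g p.1 * ((\1_A p)%:E * f' p.2))%E.
have h0 p : (0 <= h p)%E by rewrite !mule_ge0.
have mh : measurable_fun setT h.
  apply: emeasurable_funM; first exact: (measurableT_comp mg).
  apply: emeasurable_funM; first exact/measurable_EFinP/measurable_indic.
  exact: (measurableT_comp mf').
transitivity (\int[nu]_u \int[lebesgue_measure]_s h (u, s))%E.
  apply: eq_integral => u _; rewrite /h /=.
  rewrite ge0_integralZl//; last 2 first.
  - apply: emeasurable_funM mf'; apply/measurable_EFinP.
    rewrite (_ : (fun s => \1_A (u, s)) = \1_(xsection A u)).
      exact/measurable_indic/measurable_xsection.
    by apply/funext => s; rewrite !indicE mem_xsection.
  - by move=> s _; rewrite mule_ge0.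
  congr (_ * _)%E; rewrite -fphi//.
  (* The section of A at u is `[u, +oo[ for u > 0 and `]- u, +oo[ otherwise;
     the endpoint is a null set. *)
  transitivity (\int[lebesgue_measure]_(s in
      [set` Interval (BSide (0 < u)%R `|u|%R) +oo%O]) (f s)%:E)%E.
    have [u0|//] := ltP 0%R u.
    rewrite integral_itv_obnd_cbnd//; apply/measurable_EFinP.
    apply: measurable_funS mf => //; apply: subset_itvr.
    by rewrite bnd_simp normr_ge0.
  rewrite [LHS]integral_mkcond; apply: eq_integral => s _.
  have Bs : (s \in Interval (BSide (0 < u) `|u|) +oo%O) =
      (0 < s) && (- s < u <= s).
    rewrite in_itv/= andbT; case: ltP => u0 /=.
      by rewrite gtr0_norm//; apply/idP/idP; lra.
    by rewrite ler0_norm//; apply/idP/idP; lra.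
  have As : ((u, s) \in A) = (- s < u <= s).
    by apply/idP/idP; rewrite inE /A /= in_itv.
  rewrite /f' !patchE indicE As mem_setE Bs /D mem_setE in_itv/= andbT.
  by case: (0 < s); case: (- s < u <= s); rewrite ?mul1e ?mul0e ?mule0.
rewrite [LHS](@fubini_tonelli _ _ GR GR R nu lebesgue_measure h)//.
rewrite [RHS]integral_mkcond/=.
apply: eq_integral => s _; rewrite /h/= /f' !patchE.
case: ifPn => [sD|_]; last by rewrite integral0_eq// => u _; rewrite !mule0.
have fs0 : (0 <= (f s)%:E)%E by have := f'0 s; rewrite /f' patchE sD.
under eq_integral => u _ do rewrite muleCA muleA muleC.
rewrite ge0_integralZl//.
- congr (_ * _)%E; rewrite [RHS]integral_mkcond; apply: eq_integral => u _.
  rewrite patchE indicE (_ : ((u, s) \in A) = (u \in `](- s), s]%classic)).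
    by case: ifP; rewrite ?mul1e ?mul0e.
  by apply/idP/idP; rewrite !inE.
- apply: emeasurable_funM => //; apply/measurable_EFinP.
  rewrite (_ : (fun u => \1_A (u, s)) = \1_(ysection A s)).
    exact/measurable_indic/measurable_ysection.
  by apply/funext => u; rewrite !indicE mem_ysection.
- by move=> u _; rewrite mule_ge0.
Qed.

Lemma lebesgue_stieltjes_measure_itv_oc (R : realType)
    (f : cumulative R R) (a b : R) :
  a <= b -> lebesgue_stieltjes_measure f `]a, b] = (f b - f a)%:E.
Proof.
move=> ab; rewrite /lebesgue_stieltjes_measure /measure_extension/=.
rewrite measurable_mu_extE/=; last exact: is_ocitv.
by rewrite wlength_itv_bnd.
Qed.

(** * Integrals against the stable characteristic function *)

Section stable.
Variables (R : realType) (c alpha : R).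
Hypotheses (c0 : 0 < c) (alpha1 : 1 <= alpha).

Let alpha0 : 0 < alpha. Proof. exact: lt_le_trans ltr01 alpha1. Qed.

Let phi (u : R) := expR (- (c * u `^ alpha)).
Let f (u : R) := c * alpha * u `^ (alpha - 1) * phi u.

Let f_ge0 u : 0 <= f u.
Proof. by rewrite !mulr_ge0 ?powR_ge0 ?expR_ge0 ?(ltW c0) ?(ltW alpha0). Qed.

Let phi_cvg_at_right u : 0 <= u -> phi x @[x --> u^'+] --> phi u.
Proof.
move=> u0; apply: (@cvg_comp _ _ _ (fun x => - (c * x `^ alpha)) expR
      _ (nbhs (- (c * u `^ alpha)))).
  by apply: cvgN; apply: cvgMl_tmp; apply: powR_cvg_at_right => //; exact: ltW.
exact: continuous_expR.
Qed.

Let f_cvg_at_right u : 0 <= u -> f x @[x --> u^'+] --> f u.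
Proof.
move=> u0; apply: cvgM; last exact: phi_cvg_at_right.
by apply: cvgMl_tmp; apply: powR_cvg_at_right => //; rewrite subr_ge0.
Qed.

Let is_derive_phi (u : R) : 0 < u -> is_derive u 1 phi (- f u).
Proof.
move=> u0; have du := is_derive_scaled_powR R c alpha u u0.
apply: is_derive_eq.
rewrite /f /phi /GRing.scale/=; ring.
Qed.

Let continuous_f u : 0 < u -> {for u, continuous f}.
Proof.
move=> u0; apply: cvgM.
  by apply: cvgMl_tmp; exact: continuous_powR.
by apply/differentiable_continuous/derivable1_diffP; case: (is_derive_phi u u0).
Qed.

Lemma integral_stable_tail (u : R) : 0 <= u ->
  (\int[lebesgue_measure]_(s in `]u, +oo[)
    (c * alpha * s `^ (alpha - 1) * expR (- (c * s `^ alpha)))%:E =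
   (expR (- (c * u `^ alpha)))%:E)%E.
Proof.
move=> u0; have cf x : u < x -> {for x, continuous f}.
  by move=> ux; exact/continuous_f/(le_lt_trans u0).
have dphi x : u < x -> is_derive x 1 (- phi) (f x).
  move=> ux; have := is_derive_phi x (le_lt_trans u0 ux) => h.
  by apply: is_derive_eq; rewrite opprK.
have mf : measurable_fun `]u, +oo[ f.
  apply: open_continuous_measurable_fun => // x.
  by rewrite inE/= in_itv/= andbT; exact: cf.
rewrite integral_itv_obnd_cbnd; last exact/measurable_EFinP.
rewrite (@ge0_continuous_FTC2y R f (- phi) u 0).
- by rewrite sub0e -EFinN opprK.
- by [].
- apply/continuous_within_itvcyP; split; last exact: f_cvg_at_right.
  by move=> x; rewrite in_itv/= andbT; exact: cf.
- rewrite -oppr0; apply: cvgN.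
  apply: (@cvg_comp _ _ _
    (fun s => c * s `^ alpha) (fun t => expR (- t)) _ +oo).
    exact: scaled_powR_cvgy.
  exact: cvgr_expR.
- by move=> x ux; case: (dphi x ux).
- by apply: cvgN; exact: phi_cvg_at_right.
- move=> x; rewrite in_itv/= andbT => ux.
  by rewrite derive1E; case: (dphi x ux).
Qed.

(** Substitution t = c * s `^ alpha. One factor c * alpha * s `^ (alpha - 1) is
    the derivative of t; the other is alpha * c `^ (1 / alpha) times
    t `^ (1 - 1 / alpha). *)
Lemma integral_sqr_stable_slope :
  (\int[lebesgue_measure]_(s in `]0%R, +oo[)
    (c * alpha * s `^ (alpha - 1) * expR (- (c * s `^ alpha)) *
     (c * alpha * s `^ (alpha - 1)))%:E =
   (alpha * Gamma (2 - 1 / alpha) * c `^ (1 / alpha))%:E)%E.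
Proof.
have ainv : 0 < 1 / alpha <= 1.
  by rewrite divr_gt0//= ler_pdivrMr// mul1r.
have [ainv0 ainv1] := andP ainv.
pose F (s : R) := c * s `^ alpha.
pose G (t : R) := t `^ (1 - 1 / alpha) * expR (- t).
have F0 : F 0 = 0 by rewrite /F powR0 ?mulr0// gt_eqF.
have F'E s : 0 < s -> (F^`())%classic s = c * alpha * s `^ (alpha - 1).
  by move=> s0; exact: derive1_scaled_powR.
have G0 t : 0 <= G t by rewrite mulr_ge0 ?powR_ge0 ?expR_ge0.
have pointwise (s : R) : 0 < s ->
    c * alpha * s `^ (alpha - 1) * expR (- (c * s `^ alpha)) *
      (c * alpha * s `^ (alpha - 1)) =
    alpha * c `^ (1 / alpha) * (G (F s) * (c * alpha * s `^ (alpha - 1))).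
  move=> s0; rewrite /G /F powRM ?powR_ge0 ?(ltW c0)// -powRrM.
  rewrite (_ : alpha * (1 - 1 / alpha) = alpha - 1); last first.
    by field; rewrite gt_eqF.
  suff {1}-> : c = c `^ (1 / alpha) * c `^ (1 - 1 / alpha) by ring.
  rewrite -powRD; last by rewrite (gt_eqF c0) implybT.
  by rewrite addrC subrK powRr1// ltW.
have F'near (s : R) : 0 < s -> \forall x \near s,
    c * alpha * x `^ (alpha - 1) = (F^`())%classic x.
  by move=> s0; near=> x; rewrite F'E//; near: x; exact: lt_nbhsr.
have cexp : continuous (fun t : R => expR (- t)).
  move=> t; apply/differentiable_continuous/derivable1_diffP.
  exact: ex_derive.
have cG : {within `[F 0, +oo[, continuous G}.
  apply/continuous_within_itvcyP; rewrite F0; split.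
    move=> t; rewrite in_itv/= andbT => t0.
    by apply: cvgM; [exact: continuous_powR|exact: cexp].
  apply: cvgM; first by apply: powR_cvg_at_right => //; rewrite subr_ge0.
  exact/cvg_at_right_filter/cexp.
transitivity ((alpha * c `^ (1 / alpha))%:E * (Gamma (2 - 1 / alpha))%:E)%E;
  last by rewrite -EFinM; congr EFin; ring.
rewrite Gamma_integralE; last lra.
rewrite (_ : 2 - 1 / alpha - 1 = 1 - 1 / alpha); last by ring.
rewrite -[in RHS]F0.
rewrite (@increasing_ge0_integration_by_substitution_obndy R F G 0)//.
- under [in RHS]eq_integral => s.
    rewrite inE/= in_itv/= andbT => s0; rewrite F'E//; over.
  rewrite -ge0_integralZl//.
  + apply: eq_integral => s; rewrite inE/= in_itv/= andbT => s0.
    rewrite -EFinM; congr EFin; exact: pointwise.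
  + apply/measurable_EFinP/measurable_funTS/measurable_funM => //; last first.
      exact: measurable_funM.
    apply: (@measurableT_comp _ _ _ _ _ _ G); last exact: measurable_funM.
    by apply: measurable_funM => //; exact: measurableT_comp.
  + move=> s _; rewrite lee_fin mulr_ge0// !mulr_ge0 ?powR_ge0//; exact: ltW.
  + by rewrite lee_fin mulr_ge0 ?powR_ge0 ?ltW.
- move=> x y; rewrite !in_itv/= !andbT => x0 y0 xy.
  by rewrite /F ltr_pM2l// gt0_ltr_powR// nnegrE.
- move=> s; rewrite in_itv/= andbT => s0.
  apply: cvg_trans (_ : c * alpha * x `^ (alpha - 1) @[x --> s] --> _).
    by apply: near_eq_cvg; exact: F'near.
  rewrite F'E//; apply: cvgMl_tmp; exact: continuous_powR.
- apply/cvg_ex; exists (c * alpha * 0 `^ (alpha - 1)).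
  apply: cvg_trans (_ : c * alpha * x `^ (alpha - 1) @[x --> 0^'+] --> _).
    apply: near_eq_cvg; near=> s; rewrite F'E//.
  by apply: cvgMl_tmp; apply: powR_cvg_at_right => //; rewrite subr_ge0.
- split.
    move=> s; rewrite in_itv/= andbT => s0.
    by case: (is_derive_scaled_powR R c alpha s s0).
  by apply: cvgMl_tmp; apply: powR_cvg_at_right => //; exact: ltW.
- exact: scaled_powR_cvgy.
Unshelve. all: by end_near. Qed.

(** The factor m is 2 for the Stieltjes measure on the whole line and 1 for the
    density on the half-line. *)
Lemma stable_layer_cake
    (nu : {sigma_finite_measure set (measurableTypeR R) -> \bar R})
    (g : R -> \bar R) (m : R) :
  measurable_fun setT g -> (forall u, 0 <= g u)%E -> 0 <= m ->
  (forall s : R, 0 < s -> (\int[nu]_(u in `](- s)%R, s]) g u =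
    (m * (c * alpha * s `^ (alpha - 1)))%:E)%E) ->
  (\int[nu]_u (g u * (expR (- (c * `|u| `^ alpha)))%:E) =
   (m * (alpha * Gamma (2 - 1 / alpha) * c `^ (1 / alpha)))%:E)%E.
Proof.
move=> mg g0 m0 gE.
have mf : measurable_fun `](0 : R), +oo[ f.
  apply: open_continuous_measurable_fun => // x.
  by rewrite inE/= in_itv/= andbT; exact: continuous_f.
rewrite (@layer_cake R nu g f phi)//; last first.
  by move=> u u0; exact: integral_stable_tail.
rewrite EFinM -integral_sqr_stable_slope -ge0_integralZl//; last 2 first.
- apply/measurable_EFinP/measurable_funTS/measurable_funM => //; last first.
    exact: measurable_funM.
  apply: measurable_funM => //; first exact: measurable_funM.
  apply: measurableT_comp => //; apply: measurableT_comp => //.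
  exact: measurable_funM.
- move=> s _; rewrite lee_fin.
  by rewrite !mulr_ge0 ?powR_ge0 ?expR_ge0 ?(ltW c0) ?(ltW alpha0).
apply: eq_integral => s; rewrite inE/= in_itv/= andbT => s0.
by rewrite gE// -!EFinM; congr EFin; rewrite /f /phi; ring.
Qed.

End stable.

(** * The derivatives of the stable log-characteristic function *)

(** The value at 0 is the right-hand limit: it is c when alpha = 1, because
    0 `^ 0 = 1. *)
Definition stable_slope (R : realType) (c alpha u : R) : R :=
  if 0 <= u then c * alpha * u `^ (alpha - 1)
  else - (c * alpha * (- u) `^ (alpha - 1)).

Section slope.
Variables (R : realType) (c alpha : R).
Hypotheses (c0 : 0 < c) (alpha1 : 1 <= alpha).
Let alpha0 : 0 < alpha. Proof. exact: lt_le_trans ltr01 alpha1. Qed.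

Let slope_pos (u : R) : 0 <= u ->
  stable_slope R c alpha u = c * alpha * u `^ (alpha - 1).
Proof. by rewrite /stable_slope => ->. Qed.

Let slope_neg (u : R) : u < 0 ->
  stable_slope R c alpha u = - (c * alpha * (- u) `^ (alpha - 1)).
Proof. by rewrite /stable_slope ltNge => /negbTE ->. Qed.

Lemma stable_slope_nondecreasing : {homo stable_slope R c alpha : x y / x <= y}.
Proof.
have k0 : 0 <= c * alpha by rewrite mulr_ge0 ?(ltW c0) ?(ltW alpha0).
have a0 : 0 <= alpha - 1 by rewrite subr_ge0.
have pos (x y : R) : 0 <= x -> x <= y ->
    c * alpha * x `^ (alpha - 1) <= c * alpha * y `^ (alpha - 1).
  move=> x0 xy; rewrite ler_wpM2l// ge0_ler_powR ?nnegrE//.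
  exact: le_trans xy.
move=> x y xy; have [x0|x0] := leP 0 x.
  by rewrite !slope_pos//; [exact: pos|exact: le_trans xy].
have [y0|y0] := leP 0 y.
  rewrite (slope_pos y y0) (slope_neg x x0).
  by rewrite (@le_trans _ _ 0)// ?oppr_le0 mulr_ge0 ?powR_ge0.
by rewrite !slope_neg// lerN2 pos ?lerN2// oppr_ge0 ltW.
Qed.

Lemma stable_slope_right_continuous : right_continuous (stable_slope R c alpha).
Proof.
move=> u; have [u0|u0] := leP 0 u.
  rewrite slope_pos//.
  apply: cvg_trans (_ : c * alpha * x `^ (alpha - 1) @[x --> u^'+] --> _).
    apply: near_eq_cvg; near=> x; rewrite slope_pos//.
    by rewrite (le_trans u0)// ltW.
  by apply: cvgMl_tmp; apply: powR_cvg_at_right => //; rewrite subr_ge0.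
rewrite slope_neg//; apply: cvg_at_right_filter.
apply: cvg_trans (_ : - (c * alpha * (- x) `^ (alpha - 1)) @[x --> u] --> _).
  apply: near_eq_cvg; near=> x.
  rewrite -[RHS]/(stable_slope R c alpha x) slope_neg//.
  by near: x; exact: lt_nbhsl.
apply: cvgN; apply: cvgMl_tmp.
apply: (@cvg_comp _ _ _ -%R (fun x => x `^ (alpha - 1)) _ (nbhs (- u))).
  by apply: cvgN; exact: cvg_id.
by apply: continuous_powR; rewrite oppr_gt0.
Unshelve. all: by end_near. Qed.

(** At u = 0 the difference quotient is c * h `^ (alpha - 1), whose limit is c
    if alpha = 1 and 0 otherwise. *)
Lemma right_derivative_stable (u : R) :
  h^-1 * (c * `|u + h| `^ alpha - c * `|u| `^ alpha) @[h --> 0^'+] -->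
    stable_slope R c alpha u.
Proof.
have [->|uneq0] := eqVneq u 0.
  rewrite slope_pos// normr0 (powR0 (x := alpha)) ?gt_eqF// mulr0.
  have -> : c * alpha * 0 `^ (alpha - 1) = c * 0 `^ (alpha - 1).
    have [->|a1] := eqVneq alpha 1; first by rewrite mulr1.
    by rewrite powR0 ?mulr0// subr_eq0.
  apply: cvg_trans (_ : c * h `^ (alpha - 1) @[h --> 0^'+] --> _).
    apply: near_eq_cvg; near=> h; have h0 : 0 < h by [].
    rewrite add0r subr0 gtr0_norm// -[in RHS](mulr_powRB1 (ltW h0) alpha0).
    by rewrite mulrCA mulKf// gt_eqF.
  by apply: cvgMl_tmp; apply: powR_cvg_at_right => //; rewrite subr_ge0.
have du : is_derive u 1 (fun x => c * `|x| `^ alpha) (stable_slope R c alpha u).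
  have [u0|u0|u0] := ltgtP 0 u; last by rewrite u0 eqxx in uneq0.
    rewrite slope_pos ?ltW//.
    apply: near_eq_is_derive (is_derive_scaled_powR R c alpha u u0).
    near=> x; rewrite gtr0_norm//; near: x; exact: lt_nbhsr.
  rewrite slope_neg//.
  have uN0 : 0 < - u by rewrite oppr_gt0.
  have dN := @is_derive1_comp R (fun x => c * x `^ alpha) -%R u _ _
    (is_derive_scaled_powR R c alpha (- u) uN0) (is_deriveNid u 1).
  rewrite -(mulrN1 (c * _ * _)); apply: near_eq_is_derive dN.
  near=> x; rewrite /= ltr0_norm//; near: x; exact: lt_nbhsl.
case: du => dk <-.
apply: cvg_trans (cvg_dnbhs_at_right dk).
apply: near_eq_cvg; near=> h.
by rewrite /GRing.scale/= mulr1 [u + h]addrC.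
Unshelve. all: by end_near. Qed.

Lemma stable_slope_cumulative :
  exists G : cumulative R R, forall u, G u = stable_slope R c alpha u.
Proof.
pose mixin := isCumulative.Build R _ R (stable_slope R c alpha)
  stable_slope_nondecreasing stable_slope_right_continuous.
pose G : cumulative R R := HB.pack (stable_slope R c alpha) mixin.
by exists G.
Qed.

End slope.

Lemma second_derivative_stable (R : realType) (c alpha u : R) : 0 < u ->
  derive1n 2 (fun x => - (c * `|x| `^ alpha)) u =
    - (c * alpha * (alpha - 1) * u `^ (alpha - 1 - 1)).
Proof.
move=> u0.
have d1 (x : R) : 0 < x ->
    derive1 (fun x => - (c * `|x| `^ alpha)) x = - c * alpha * x `^ (alpha - 1).
  move=> x0; rewrite -(derive1_scaled_powR _ _ _ _ x0) !derive1E.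
  apply: near_eq_derive; near=> y; rewrite gtr0_norm ?mulNr//.
  by near: y; exact: lt_nbhsr.
rewrite /= -!mulNr -(derive1_scaled_powR _ _ _ _ u0).
rewrite [LHS]derive1E [RHS]derive1E.
by apply: near_eq_derive; near=> y; rewrite d1//; near: y; exact: lt_nbhsr.
Unshelve. all: by end_near. Qed.

Lemma integral_stable_curvature_density (R : realType) (c alpha s : R) :
  0 < c -> 1 < alpha -> 0 < s ->
  (\int[lebesgue_measure]_(u in `]0%R, s])
     (c * alpha * (alpha - 1) * u `^ (alpha - 1 - 1))%:E =
   (c * alpha * s `^ (alpha - 1))%:E)%E.
Proof.
move=> c0 a1 s0; have a0 : 0 < alpha by exact: lt_trans ltr01 a1.
have am1 : 0 < alpha - 1 by rewrite subr_gt0.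
have dF (u : R) : 0 < u -> is_derive u 1 (fun u => c * alpha * u `^ (alpha - 1))
    (c * alpha * (alpha - 1) * u `^ (alpha - 1 - 1)).
  exact: is_derive_scaled_powR.
rewrite (ge0_continuous_FTC2_oc _ _ _ _ _ s0 _ _ dF).
- by rewrite powR0 ?mulr0 ?subr0// gt_eqF.
- by move=> u u0; rewrite !mulr_ge0 ?powR_ge0 ?(ltW c0) ?(ltW a0) ?(ltW am1).
- by move=> u u0; apply: cvgMl_tmp; exact: continuous_powR.
- by apply: cvgMl_tmp; apply: powR_cvg_at_right0; exact: ltW.
Qed.

Theorem theorem7 (d : measure_display) (T : measurableType d) (R : realType)
    (P : probability T R) (X : {RV P >-> R}) (c alpha H : R)
    (c_gt0 : 0 < c) (alpha_range : 1 <= alpha <= 2)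
    (X_stable : forall u : R,
      char_fun P X u = real_complex R (expR (- (c * `|u| `^ alpha))))
    (Hurst : H = 1 / alpha) :
  [/\ char_curvature P X =
        ((2 / Num.sqrt (2 * pi))%:E *
         \int[lebesgue_measure]_(u in `]0%R, +oo[)
           ((- (derive1n 2 (log_char_fun P X) u))
            * expR (- (c * u `^ alpha)))%:E)%E,
      1 < alpha ->
        char_curvature P X =
          (2 / Num.sqrt (2 * pi) * alpha * Gamma (2 - 1 / alpha)
             * c `^ (1 / alpha))%:E,
      is_distributional_char_curvature P X
        (2 / Num.sqrt (2 * pi) * alpha * Gamma (2 - 1 / alpha)
           * c `^ (1 / alpha))%:E
    & 2 / Num.sqrt (2 * pi) * alpha * Gamma (2 - 1 / alpha) * c `^ (1 / alpha)
      = 2 / (H * Num.sqrt (2 * pi)) * Gamma (2 - H) * c `^ H ].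
Proof.
have [a1 _] := andP alpha_range.
have a0 : 0 < alpha by exact: lt_le_trans ltr01 a1.
have phiE u : real_char_fun P X u = expR (- (c * `|u| `^ alpha)).
  by rewrite /real_char_fun X_stable.
have logE : log_char_fun P X = fun u => - (c * `|u| `^ alpha).
  by apply/funext => u; rewrite /log_char_fun phiE expRK.
split.
- congr (_ * _)%E; apply: eq_integral => u; rewrite inE/= in_itv/= andbT => u0.
  by rewrite phiE gtr0_norm.
- move=> alpha_gt1; rewrite /char_curvature.
  pose g : R -> \bar R :=
    (fun u => (c * alpha * (alpha - 1) * u `^ (alpha - 1 - 1))%:E)
      \_ `](0 : R), +oo[.
  have k0 : 0 <= c * alpha * (alpha - 1).
    by rewrite !mulr_ge0 ?subr_ge0 ?(ltW c_gt0) ?(ltW a0).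
  transitivity ((2 / Num.sqrt (2 * pi))%:E *
      (1 * (alpha * Gamma (2 - 1 / alpha) * c `^ (1 / alpha)))%:E)%E;
    last first.
    by rewrite -EFinM mul1r !mulrA.
  congr (_ * _)%E.
  transitivity (\int[lebesgue_measure]_u
      (g u * (expR (- (c * `|u| `^ alpha)))%:E))%E.
    rewrite [LHS]integral_mkcond; apply: eq_integral => u _; rewrite /g !patchE.
    case: ifPn => [u_in|_]; last by rewrite mul0e.
    have u0 : 0 < u by move: u_in; rewrite inE/= in_itv/= andbT.
    by rewrite logE second_derivative_stable// opprK phiE EFinM.
  rewrite (@stable_layer_cake R c alpha c_gt0 a1 lebesgue_measure g 1)//.
  + apply/(measurable_restrictT _ (measurable_itv _))/measurable_EFinP.
    by apply: measurable_funTS; exact: measurable_funM.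
  + move=> u; rewrite /g patchE; case: ifP => // _.
    by rewrite lee_fin mulr_ge0 ?powR_ge0.
  + move=> s s0; rewrite mul1r /g -integral_mkcondr.
    rewrite -integral_stable_curvature_density//; congr integral.
    apply/seteqP; split => u /=; rewrite !in_itv/= andbT.
      by move=> [/andP[_ ->] ->].
    move=> /andP[u0 ->]; split=> //.
    by rewrite andbT (lt_trans _ u0)// oppr_lt0.
- have [G GE] := stable_slope_cumulative R c alpha c_gt0 a1.
  exists G; split.
    move=> u; rewrite GE.
    under eq_fun do rewrite logE !opprK.
    exact: right_derivative_stable.
  transitivity ((1 / Num.sqrt (2 * pi))%:E *
      (2 * (alpha * Gamma (2 - 1 / alpha) * c `^ (1 / alpha)))%:E)%E.
    by rewrite -EFinM; congr EFin; ring.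
  congr (_ * _)%E.
  rewrite -(@stable_layer_cake R c alpha c_gt0 a1
    (lebesgue_stieltjes_measure G) (cst 1%E))//.
  + by apply: eq_integral => u _; rewrite mul1e phiE.
  + move=> s s0; rewrite integral_cst// mul1e.
    rewrite [LHS]lebesgue_stieltjes_measure_itv_oc; last first.
      by rewrite lerNl; lra.
    rewrite !GE /stable_slope (ltW s0) oppr_ge0 leNgt s0/= !opprK.
    by congr EFin; ring.
- rewrite Hurst; congr (_ * _ * _).
  by rewrite invfM div1r invrK (mulrC alpha) mulrA.
Qed.
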